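(* Consider the scalar deterministic problem of the context with constant control coefficient $g$ (so $g^x=0$), and suppose the solution $J(t,x)$ of the deterministic HJB equation is sufficiently smooth. Let $\bar x_t$, $t\in[0,T]$, be the optimal nominal trajectory from a given initial state $x_0$, and expand, with $\delta x_t=x_t-\bar x_t$, $$J(t,x_t)=\bar J_t+G_t\,\delta x_t+\tfrac12P_t\,\delta x_t^2+\tfrac16S_t\,\delta x_t^3+\cdots.$$ Then $G_t,P_t,S_t$ satisfy $$\dot G_t+\bar l_t^x+\bar f_t^xG_t=0,$$ $$\dot P_t+\bar l_t^{xx}+P_t\bar f_t^x+\bar f_t^xP_t-P_t\frac{g^2}{r}P_t+\bar f_t^{xx}G_t=0,$$ $$\dot S_t+\bar l_t^{xxx}+P_t\bar f_t^{xx}+2\bar f_t^{xx}P_t+\bar f_t^xS_t+2S_t\bar f_t^x-P_t\frac{g^2}{r}S_t-2S_t\frac{g^2}{r}P_t+\bar f_t^{xxx}G_t=0,$$ and the optimal feedback law is $$u(t,x_t)=\bar u_t+K_t\,\delta x_t+K_t^{(2)}\,\delta x_t^2+O(\delta x_t^3),\qquad \bar u_t=-\frac grG_t,\quad K_t=-\frac grP_t,\quad K_t^{(2)}=-\frac g{2r}S_t.$$ In particular, the equation for $G_t$ does not involve $P_t$ or $S_t$, and the equation for $P_t$ does not involve $S_t$: the higher-order terms do not affect the lower-order terms along the nominal trajectory.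
   Context: Scalar deterministic problem: minimize $\int_0^T\big(l(x)+\frac12ru^2\big)\,dt+c_T(x_T)$ with $r>0$, subject to $\dot x=f(x)+gu$, $x\in\mathbb{R}$, $u\in\mathbb{R}$, $x(0)=x_0$. The functions $f,l,c_T$ are five times continuously differentiable. The deterministic HJB equation is $\frac{\partial J}{\partial t}+l(x)-\frac12\frac{g^2}{r}(J^x)^2+f(x)J^x=0$ with $J(T,x)=c_T(x)$, where $J^x=\partial J/\partial x$; it is assumed to have a smooth solution, and the optimal feedback law is $u(t,x)=-\frac grJ^x(t,x)$. Notation: $\bar J_t=J(t,\bar x_t)$; $G_t,P_t,S_t$ are the first, second and third $x$-derivatives of $J(t,\cdot)$ at $\bar x_t$; $\bar f_t^x,\bar f_t^{xx},\bar f_t^{xxx}$ and $\bar l_t^x,\bar l_t^{xx},\bar l_t^{xxx}$ are the first, second and third derivatives of $f$ and $l$ at $\bar x_t$. A dot denotes the total derivative in $t$ along the nominal trajectory, which satisfies $\dot{\bar x}_t=f(\bar x_t)-\frac{g^2}{r}G_t$. *)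

(* Defs.v *)
(* Real analysis over Stdlib's R, with Coquelicot. *)
From Stdlib Require Import Reals.
From Coquelicot Require Import Coquelicot.
Open Scope R_scope.

(* Derivative of F at t relative to [0,T]: two-sided inside, one-sided at
   the two endpoints. *)
Definition is_derive_on (T : R) (F : R -> R) (t l : R) : Prop :=
  filterdiff F (within (fun s => 0 <= s <= T) (locally t))
             (fun y => scal y l).

Definition Cn (n : nat) (h : R -> R) : Prop :=
  forall (k : nat) (x : R), (k <= n)%nat ->
    ex_derive_n h k x /\ continuous (Derive_n h k) x.

(* F(t,x) is of class C^n on the strip [0,T] x R: both first partial
   derivatives exist and are of class C^(n-1); C^0 is joint continuity. *)
Fixpoint Cn_strip (T : R) (n : nat) (F : R -> R -> R) : Prop :=
  match n with
  | O => continuous_on (fun p : R * R => 0 <= fst p <= T)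
                       (fun p : R * R => F (fst p) (snd p))
  | S m => exists Ft Fx : R -> R -> R,
      (forall t x : R, 0 <= t <= T ->
         is_derive_on T (fun s => F s x) t (Ft t x) /\
         is_derive (F t) x (Fx t x)) /\
      Cn_strip T m Ft /\ Cn_strip T m Fx
  end.

Definition cost (l cT : R -> R) (r T : R) (x u : R -> R) : R :=
  RInt (fun t => l (x t) + / 2 * r * (u t) ^ 2) 0 T + cT (x T).

Definition admissible (f : R -> R) (g T x0 : R) (x u : R -> R) : Prop :=
  x 0 = x0 /\
  continuous_on (fun t => 0 <= t <= T) u /\
  forall t : R, 0 <= t <= T -> is_derive_on T x t (f (x t) + g * u t).

Definition optimal_pair (f l cT : R -> R) (g r T x0 : R)
    (xbar ubar : R -> R) : Prop :=
  admissible f g T x0 xbar ubar /\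
  forall x u : R -> R, admissible f g T x0 x u ->
    cost l cT r T xbar ubar <= cost l cT r T x u.

Definition HJB (f l cT : R -> R) (g r T : R) (J : R -> R -> R) : Prop :=
  (forall t x : R, 0 <= t <= T ->
     exists Jt : R,
       is_derive_on T (fun s => J s x) t Jt /\
       Jt + l x - / 2 * (g ^ 2 / r) * (Derive (J t) x) ^ 2
         + f x * Derive (J t) x = 0) /\
  (forall x : R, J T x = cT x).

Definition optimal_feedback (g r : R) (J : R -> R -> R) (t x : R) : R :=
  - (g / r) * Derive (J t) x.

(* Optimal nominal trajectory from x0, with its control: an optimal pair
   generated by the optimal feedback law. *)
Definition optimal_nominal (f l cT : R -> R) (g r T x0 : R)
    (J : R -> R -> R) (xbar ubar : R -> R) : Prop :=
  optimal_pair f l cT g r T x0 xbar ubar /\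
  forall t : R, 0 <= t <= T -> ubar t = optimal_feedback g r J t (xbar t).

(* E(t,d) = O(d^n) as d -> 0, uniformly in t in [0,T]. *)
Definition is_bigO_pow (T : R) (n : nat) (E : R -> R -> R) : Prop :=
  exists C eps : R, 0 < eps /\
    forall t d : R, 0 <= t <= T -> Rabs d < eps ->
      Rabs (E t d) <= C * Rabs d ^ n.

(* Main.v *)
(* Differentiating the HJB equation one, two and three times in x and commuting
   the x-derivatives with the t-derivative gives the t-derivatives of J^x, J^xx
   and J^xxx. In the chain rule along xbar' = f(xbar) - (g^2/r) J^x, the
   transport term of highest order cancels the highest x-derivative coming from
   f J^x - (g^2/2r) (J^x)^2, which leaves closed equations for G, P and S. *)
Require Import Defs.
From Stdlib Require Import Reals Lra Lia Classical IndefiniteDescription.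
From Coquelicot Require Import Coquelicot.
Open Scope R_scope.

(** * Derivatives relative to [0,T] and continuity on the strip *)

(** Turns the filter condition into an estimate that also covers the endpoints, where only
    increments staying in [0,T] are tested. *)
Lemma is_derive_on_iff (T : R) (F : R -> R) (t l : R) (ht : 0 <= t <= T) :
  is_derive_on T F t l <->
  forall eps, 0 < eps -> exists delta, 0 < delta /\
    forall s, 0 <= s <= T -> Rabs (s - t) < delta ->
      Rabs (F s - F t - (s - t) * l) <= eps * Rabs (s - t).
Proof.
split.
- intros [_ H] eps heps.
  assert (Hl : is_filter_lim (within (fun s => 0 <= s <= T) (locally t)) t).
  { intros Q [d Hd]. exists d. intros y Hy _. now apply Hd. }
  destruct (H t Hl (mkposreal eps heps)) as [d Hd].
  exists d. split. apply cond_pos.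
  intros s hs hst. exact (Hd s hst hs).
- intros H. split.
  + apply (is_linear_scal_l (V := R_NormedModule) l).
  + intros x Hx.
    (* Since [t] lies in [0,T], it belongs to every set of the filter; a limit [x] other than [t] is
       excluded by the ball around [x] of radius |t - x|. *)
    assert (x = t) as ->.
    { apply NNPP; intro ne.
      assert (hp : 0 < Rabs (t - x)) by (apply Rabs_pos_lt; lra).
      destruct (Hx _ (locally_ball x (mkposreal _ hp))) as [d Hd].
      assert (Hb := Hd t (ball_center t d) ht).
      change (Rabs (t - x) < Rabs (t - x)) in Hb. lra. }
    intros [eps heps].
    destruct (H eps heps) as [d [hd Hd]].
    exists (mkposreal d hd). intros s hs hT. exact (Hd s hT hs).
Qed.

(** Balls of [R * R] are products of intervals, so joint closeness splits into one condition on [s]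
    and one on [y]. *)
Lemma continuous_strip_iff (T : R) (F : R -> R -> R) :
  Cn_strip T 0 F <->
  forall t x, 0 <= t <= T -> forall eps, 0 < eps -> exists delta, 0 < delta /\
    forall s y, 0 <= s <= T -> Rabs (s - t) < delta -> Rabs (y - x) < delta ->
      Rabs (F s y - F t x) < eps.
Proof.
split.
- intros H t x ht eps heps.
  assert (Hl := H (t, x) ht _ (locally_ball _ (mkposreal eps heps))).
  destruct Hl as [d Hd]. exists d. split. apply cond_pos.
  intros s y hs hst hyx. exact (Hd (s, y) (conj hst hyx) hs).
- intros H [t x] ht Q [e He].
  destruct (H t x ht e (cond_pos e)) as [d [hd Hd]].
  exists (mkposreal d hd). intros [s y] [hs hy] hD. apply He.
  exact (Hd s y hD hs hy).
Qed.

Lemma is_derive_on_continuous (T : R) (F : R -> R) (t l : R) (ht : 0 <= t <= T) :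
  is_derive_on T F t l ->
  forall eps, 0 < eps -> exists delta, 0 < delta /\
    forall s, 0 <= s <= T -> Rabs (s - t) < delta -> Rabs (F s - F t) < eps.
Proof.
intros H eps heps.
destruct (proj1 (is_derive_on_iff T F t l ht) H 1 Rlt_0_1) as [d [hd Hd]].
assert (hl : 0 < Rabs l + 1) by (pose proof (Rabs_pos l); lra).
exists (Rmin d (eps / (Rabs l + 1))). split.
{ apply Rmin_pos; [lra|]. apply Rdiv_lt_0_compat; lra. }
intros s hs hst.
assert (h1 := Rlt_le_trans _ _ _ hst (Rmin_l _ _)).
assert (h2 := Rlt_le_trans _ _ _ hst (Rmin_r _ _)).
apply Rlt_div_r in h2; [|lra].
specialize (Hd s hs h1).
replace (F s - F t) with ((F s - F t - (s - t) * l) + (s - t) * l) by ring.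
eapply Rle_lt_trans; [apply Rabs_triang|].
rewrite (Rabs_mult (s - t)). lra.
Qed.

(** A step of at most T/2 towards the farther endpoint stays in [0,T], so test points exist even
    when [t] is an endpoint. *)
Lemma interval_nearby (T t d : R) :
  0 < T -> 0 <= t <= T -> 0 < d ->
  exists s, 0 <= s <= T /\ s <> t /\ Rabs (s - t) < d.
Proof.
intros hT ht hd.
assert (hm : 0 < Rmin (d / 2) (T / 2)) by (apply Rmin_pos; lra).
assert (h1 := Rmin_l (d / 2) (T / 2)).
assert (h2 := Rmin_r (d / 2) (T / 2)).
destruct (Rle_dec t (T / 2)).
- exists (t + Rmin (d / 2) (T / 2)). split; [lra|split; [lra|]].
  apply Rabs_def1; lra.
- exists (t - Rmin (d / 2) (T / 2)). split; [lra|split; [lra|]].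
  apply Rabs_def1; lra.
Qed.

Lemma eq_of_le_eps (a b : R) :
  (forall eps, 0 < eps -> Rabs (a - b) <= eps) -> a = b.
Proof.
intros H. destruct (Req_dec a b) as [|ne]; [assumption|exfalso].
assert (hp : 0 < Rabs (a - b)) by (apply Rabs_pos_lt; lra).
specialize (H (Rabs (a - b) / 2)). lra.
Qed.

(** The two error terms differ by (s - t)(l1 - l2), tested at some [s] other than [t]. This later
    identifies the t-derivative in [HJB] with the one supplied by [Cn_strip]. *)
Lemma is_derive_on_unique (T : R) (F : R -> R) (t l1 l2 : R) :
  0 < T -> 0 <= t <= T ->
  is_derive_on T F t l1 -> is_derive_on T F t l2 -> l1 = l2.
Proof.
intros hT ht H1 H2. apply eq_of_le_eps. intros eps heps.
assert (he : 0 < eps / 2) by lra.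
destruct (proj1 (is_derive_on_iff _ _ _ _ ht) H1 _ he) as [d1 [hd1 Hd1]].
destruct (proj1 (is_derive_on_iff _ _ _ _ ht) H2 _ he) as [d2 [hd2 Hd2]].
destruct (interval_nearby T t (Rmin d1 d2) hT ht (Rmin_pos _ _ hd1 hd2))
  as [s [hs [hne hst]]].
specialize (Hd1 s hs (Rlt_le_trans _ _ _ hst (Rmin_l _ _))).
specialize (Hd2 s hs (Rlt_le_trans _ _ _ hst (Rmin_r _ _))).
assert (hp : 0 < Rabs (s - t)) by (apply Rabs_pos_lt; lra).
apply Rmult_le_reg_l with (1 := hp).
rewrite <- Rabs_mult.
replace ((s - t) * (l1 - l2))
  with ((F s - F t - (s - t) * l2) - (F s - F t - (s - t) * l1)) by ring.
eapply Rle_trans; [apply Rabs_triang|]. rewrite Rabs_Ropp. lra.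
Qed.

Lemma is_derive_on_interior (T : R) (F : R -> R) (t l : R) :
  0 < t < T -> is_derive_on T F t l -> is_derive F t l.
Proof.
intros ht [_ H]. split; [apply (is_linear_scal_l (V := R_NormedModule) l)|].
intros x Hx eps.
assert (x = t) as -> by (symmetry; now apply (is_filter_lim_locally_unique t x)).
assert (hl : is_filter_lim (within (fun s => 0 <= s <= T) (locally t)) t).
{ intros Q [d Hd]. exists d. intros y Hy _. now apply Hd. }
destruct (H t hl eps) as [d Hd].
assert (hm : 0 < Rmin d (Rmin t (T - t))).
{ repeat apply Rmin_pos; try lra. apply cond_pos. }
exists (mkposreal _ hm). intros s hs.
change (Rabs (s - t) < Rmin d (Rmin t (T - t))) in hs.
assert (h1 := Rlt_le_trans _ _ _ hs (Rmin_l _ _)).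
assert (h2 := Rlt_le_trans _ _ _ hs (Rmin_r _ _)).
assert (h3 := Rlt_le_trans _ _ _ h2 (Rmin_l _ _)).
assert (h4 := Rlt_le_trans _ _ _ h2 (Rmin_r _ _)).
apply Rabs_def2 in h3. apply Rabs_def2 in h4.
apply Hd; [exact h1|lra].
Qed.

(** * Mean value theorems *)

(** The position of [c] is given by its distance to [a], so that [b] may lie on either side of
    [a]. *)
Lemma MVT_is_derive (F F' : R -> R) (a b : R) :
  (forall x, is_derive F x (F' x)) ->
  exists c, Rabs (c - a) <= Rabs (b - a) /\ F b - F a = F' c * (b - a).
Proof.
intros H.
destruct (MVT_gen F a b F') as [c [hc Hc]].
- intros x _. apply H.
- intros x _. apply continuity_pt_filterlim.
  apply (ex_derive_continuous F x). now exists (F' x).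
- exists c. split; [|exact Hc].
  unfold Rmin, Rmax in hc. destruct (Rle_dec a b).
  + rewrite !Rabs_pos_eq; lra.
  + rewrite !Rabs_left1; lra.
Qed.

(* Precomposing with the projection onto [0,T] makes F continuous on the whole
   line, so that the usual mean value theorem applies. *)
Lemma MVT_is_derive_on (T : R) (F F' : R -> R) (a b : R) :
  0 <= a <= T -> 0 <= b <= T ->
  (forall t, 0 <= t <= T -> is_derive_on T F t (F' t)) ->
  exists c, 0 <= c <= T /\ Rabs (c - a) <= Rabs (b - a) /\
    F b - F a = F' c * (b - a).
Proof.
intros ha hb H.
set (clamp := fun s => Rmax 0 (Rmin T s)).
assert (clampE : forall s, 0 <= s <= T -> clamp s = s).
{ intros s hs. unfold clamp. rewrite Rmin_right, Rmax_right; lra. }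
assert (clamp_in : forall s, 0 <= clamp s <= T).
{ intros s. unfold clamp, Rmax, Rmin.
  repeat destruct Rle_dec; lra. }
destruct (MVT_gen (fun s => F (clamp s)) a b F') as [c [hc Hc]].
- intros t ht.
  assert (hi : 0 < t < T).
  { unfold Rmin, Rmax in ht. destruct (Rle_dec a b); lra. }
  apply is_derive_ext_loc with F.
  + assert (hm : 0 < Rmin t (T - t)) by (apply Rmin_pos; lra).
    exists (mkposreal _ hm). intros s hs.
    change (Rabs (s - t) < Rmin t (T - t)) in hs.
    assert (h3 := Rlt_le_trans _ _ _ hs (Rmin_l _ _)).
    assert (h4 := Rlt_le_trans _ _ _ hs (Rmin_r _ _)).
    apply Rabs_def2 in h3. apply Rabs_def2 in h4.
    rewrite clampE; [reflexivity|lra].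
  + apply is_derive_on_interior with T; [exact hi|]. apply H; lra.
- intros t ht.
  assert (hi : 0 <= t <= T).
  { unfold Rmin, Rmax in ht. destruct (Rle_dec a b); lra. }
  intros eps heps.
  destruct (is_derive_on_continuous T F t _ hi (H t hi) eps heps)
    as [d [hd Hd]].
  exists d. split; [exact hd|]. intros s [_ hs].
  simpl in hs |- *. unfold Rdist in hs |- *.
  rewrite (clampE t hi). apply Hd; [apply clamp_in|].
  eapply Rle_lt_trans; [|exact hs].
  (* The projection moves no [s] farther from the point [t] of [0,T]. *)
  clear - hi. unfold clamp, Rmax, Rmin, Rabs.
  repeat destruct Rle_dec; repeat destruct Rcase_abs; lra.
- exists c. simpl in Hc. rewrite !clampE in Hc by assumption.
  unfold Rmin, Rmax in hc.
  destruct (Rle_dec a b); (split; [lra|split; [|exact Hc]]).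
  + rewrite !Rabs_pos_eq; lra.
  + rewrite !Rabs_left1; lra.
Qed.

(** * Continuity, mixed partials and the chain rule on the strip *)

(** The increment is split into a move in x at time [s], controlled by the mean value theorem and a
    local bound on [Fx], and a move in t at the fixed point [x]. *)
Lemma continuous_strip_of_partials (T : R) (F Ft Fx : R -> R -> R) :
  (forall t x, 0 <= t <= T ->
     is_derive_on T (fun s => F s x) t (Ft t x) /\
     is_derive (F t) x (Fx t x)) ->
  Cn_strip T 0 Fx -> Cn_strip T 0 F.
Proof.
intros H hFx. apply continuous_strip_iff. intros t x ht eps heps.
assert (he : 0 < eps / 2) by lra.
destruct (proj1 (continuous_strip_iff T Fx) hFx t x ht 1 Rlt_0_1)
  as [d1 [hd1 Hd1]].
destruct (is_derive_on_continuous T _ t _ ht (proj1 (H t x ht)) _ he)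
  as [d2 [hd2 Hd2]].
(* [M] bounds [Fx] on the neighbourhood of (t,x) where [Fx] varies by less than 1. *)
set (M := Rabs (Fx t x) + 1).
assert (hM : 0 < M) by (unfold M; pose proof (Rabs_pos (Fx t x)); lra).
exists (Rmin d1 (Rmin d2 (eps / 2 / M))). split.
{ repeat apply Rmin_pos; try lra. apply Rdiv_lt_0_compat; lra. }
intros s y hs hst hyx.
assert (a1 := Rlt_le_trans _ _ _ hst (Rmin_l _ _)).
assert (a2 := Rlt_le_trans _ _ _ hst (Rmin_r _ _)).
assert (a3 := Rlt_le_trans _ _ _ a2 (Rmin_l _ _)).
assert (b1 := Rlt_le_trans _ _ _ hyx (Rmin_l _ _)).
assert (b2 := Rlt_le_trans _ _ _ hyx (Rmin_r _ _)).
assert (b3 := Rlt_le_trans _ _ _ b2 (Rmin_r _ _)).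
apply Rlt_div_r in b3; [|exact hM].
destruct (MVT_is_derive (F s) (Fx s) x y) as [c [hc Hc]].
{ intros z. exact (proj2 (H s z hs)). }
specialize (Hd1 s c hs a1 (Rle_lt_trans _ _ _ hc b1)).
specialize (Hd2 s hs a3). simpl in Hd2.
replace (F s y - F t x) with ((F s y - F s x) + (F s x - F t x)) by ring.
eapply Rle_lt_trans; [apply Rabs_triang|].
rewrite Hc, Rabs_mult.
assert (hb : Rabs (Fx s c) <= M).
{ unfold M. replace (Fx s c) with (Fx t x + (Fx s c - Fx t x)) by ring.
  eapply Rle_trans; [apply Rabs_triang|]. lra. }
assert (Rabs (Fx s c) * Rabs (y - x) <= M * Rabs (y - x)).
{ apply Rmult_le_compat_r; [apply Rabs_pos|exact hb]. }
lra.
Qed.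

(** For positive order, [Cn_strip] asserts joint continuity only of the last derivatives; it is
    passed back from [Fx] to [F] by induction. *)
Lemma Cn_strip_continuous (T : R) (n : nat) :
  forall F, Cn_strip T n F -> Cn_strip T 0 F.
Proof.
induction n as [|n IH]; intros F H; [exact H|].
destruct H as [Ft [Fx [H [_ hFx]]]].
exact (continuous_strip_of_partials T F Ft Fx H (IH _ hFx)).
Qed.

(* Both orders of the mean value theorem on a small rectangle express the same
   second difference; t may be an endpoint of [0,T]. *)
Lemma mixed_partials_strip (T : R) (F Ft Fx Ftx Fxt : R -> R -> R) :
  0 < T ->
  (forall t x, 0 <= t <= T ->
     is_derive_on T (fun s => F s x) t (Ft t x) /\
     is_derive (F t) x (Fx t x)) ->
  (forall t x, 0 <= t <= T -> is_derive (Ft t) x (Ftx t x)) ->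
  (forall t x, 0 <= t <= T -> is_derive_on T (fun s => Fx s x) t (Fxt t x)) ->
  Cn_strip T 0 Ftx -> Cn_strip T 0 Fxt ->
  forall t x, 0 <= t <= T -> Ftx t x = Fxt t x.
Proof.
intros hT H Htx Hxt ctx cxt t x ht. apply eq_of_le_eps. intros eps heps.
assert (he : 0 < eps / 2) by lra.
destruct (proj1 (continuous_strip_iff T _) ctx t x ht _ he) as [d1 [hd1 Hd1]].
destruct (proj1 (continuous_strip_iff T _) cxt t x ht _ he) as [d2 [hd2 Hd2]].
set (d := Rmin d1 d2).
assert (hd : 0 < d) by (apply Rmin_pos; assumption).
assert (k1 : d <= d1) by apply Rmin_l.
assert (k2 : d <= d2) by apply Rmin_r.
destruct (interval_nearby T t d hT ht hd) as [s [hs [hne hst]]].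
set (y := x + d / 2).
assert (hyx : Rabs (y - x) < d).
{ unfold y. replace (x + d / 2 - x) with (d / 2) by ring.
  rewrite Rabs_pos_eq; lra. }
(* First order: the second difference is resolved in x, then in t. *)
destruct (MVT_is_derive (fun z => F s z - F t z) (fun z => Fx s z - Fx t z) x y)
  as [c1 [hc1 E1]].
{ intros z. apply (is_derive_minus (F s) (F t)); apply H; assumption. }
destruct (MVT_is_derive_on T (fun q => Fx q c1) (fun q => Fxt q c1) t s ht hs)
  as [q1 [hq1 [hqt1 E2]]].
{ intros q hq. now apply Hxt. }
(* Second order: the same difference is resolved in t, then in x. *)
destruct (MVT_is_derive_on T (fun q => F q y - F q x) (fun q => Ft q y - Ft q x)
            t s ht hs) as [q2 [hq2 [hqt2 E3]]].
{ intros q hq.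
  apply filterdiff_ext_lin
    with (fun z => minus (scal z (Ft q y)) (scal z (Ft q x))).
  - apply (filterdiff_minus_fct (fun q => F q y) (fun q => F q x)).
    + apply (H q y hq).
    + apply (H q x hq).
  - intros z. unfold minus, plus, opp, scal; simpl. unfold mult; simpl. ring. }
destruct (MVT_is_derive (Ft q2) (Ftx q2) x y) as [c2 [hc2 E4]].
{ intros z. now apply Htx. }
(* Dividing by (y - x)(s - t) equates values of the two mixed partials at two points near (t,x);
   continuity then brings both back to (t,x). *)
assert (E : Ftx q2 c2 = Fxt q1 c1).
{ cbv beta in E1, E2, E3.
  assert (hn : (y - x) * (s - t) <> 0).
  { apply Rmult_integral_contrapositive. split; [unfold y; lra|lra]. }
  apply Rmult_eq_reg_r with (2 := hn).
  rewrite E2 in E1. rewrite E4 in E3. lra. }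
specialize (Hd1 q2 c2 hq2 ltac:(lra) ltac:(lra)).
specialize (Hd2 q1 c1 hq1 ltac:(lra) ltac:(lra)).
rewrite E in Hd1.
replace (Ftx t x - Fxt t x)
  with ((Fxt q1 c1 - Fxt t x) - (Fxt q1 c1 - Ftx t x)) by ring.
eapply Rle_trans; [apply Rabs_triang|]. rewrite Rabs_Ropp. lra.
Qed.

(** The error splits into three: that of the t-derivative at the fixed point [x t], the variation of
    [Fx] times the increment of [x], and [Fx] times the linearization error of [x]. Each receives
    eps/3. *)
Lemma is_derive_on_comp_strip (T : R) (F Ft Fx : R -> R -> R) (x : R -> R)
    (t v : R) :
  (forall t x, 0 <= t <= T ->
     is_derive_on T (fun s => F s x) t (Ft t x) /\
     is_derive (F t) x (Fx t x)) ->
  Cn_strip T 0 Fx ->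
  0 <= t <= T -> is_derive_on T x t v ->
  is_derive_on T (fun s => F s (x s)) t (Ft t (x t) + Fx t (x t) * v).
Proof.
intros H cFx ht hx. apply is_derive_on_iff; [exact ht|]. intros eps heps.
(* [A] dominates |Fx| at the base point and [B] is a Lipschitz constant of [x] at [t]; the added 1
   keeps both positive as divisors. *)
set (A := Rabs (Fx t (x t)) + 1). set (B := Rabs v + 1).
assert (hA : 0 < A) by (unfold A; pose proof (Rabs_pos (Fx t (x t))); lra).
assert (hB : 0 < B) by (unfold B; pose proof (Rabs_pos v); lra).
destruct (proj1 (is_derive_on_iff _ _ _ _ ht) (proj1 (H t (x t) ht)) (eps / 3)
            ltac:(lra)) as [d1 [hd1 Hd1]].
destruct (proj1 (is_derive_on_iff _ _ _ _ ht) hx (eps / 3 / A)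
            ltac:(apply Rdiv_lt_0_compat; lra)) as [d2 [hd2 Hd2]].
destruct (proj1 (is_derive_on_iff _ _ _ _ ht) hx 1 Rlt_0_1) as [d3 [hd3 Hd3]].
destruct (proj1 (continuous_strip_iff T _) cFx t (x t) ht (eps / 3 / B)
            ltac:(apply Rdiv_lt_0_compat; lra)) as [d4 [hd4 Hd4]].
destruct (is_derive_on_continuous T x t v ht hx d4 hd4) as [d5 [hd5 Hd5]].
exists (Rmin d1 (Rmin d2 (Rmin d3 (Rmin d4 d5)))). split.
{ repeat apply Rmin_pos; assumption. }
intros s hs hst.
assert (k1 := Rlt_le_trans _ _ _ hst (Rmin_l _ _)).
assert (m1 := Rlt_le_trans _ _ _ hst (Rmin_r _ _)).
assert (k2 := Rlt_le_trans _ _ _ m1 (Rmin_l _ _)).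
assert (m2 := Rlt_le_trans _ _ _ m1 (Rmin_r _ _)).
assert (k3 := Rlt_le_trans _ _ _ m2 (Rmin_l _ _)).
assert (m3 := Rlt_le_trans _ _ _ m2 (Rmin_r _ _)).
assert (k4 := Rlt_le_trans _ _ _ m3 (Rmin_l _ _)).
assert (k5 := Rlt_le_trans _ _ _ m3 (Rmin_r _ _)).
specialize (Hd1 s hs k1). specialize (Hd2 s hs k2). specialize (Hd3 s hs k3).
specialize (Hd5 s hs k5). cbv beta in Hd1.
destruct (MVT_is_derive (F s) (Fx s) (x t) (x s)) as [c [hc E]].
{ intros z. exact (proj2 (H s z hs)). }
specialize (Hd4 s c hs k4 ltac:(lra)).
replace (F s (x s) - F t (x t) - (s - t) * (Ft t (x t) + Fx t (x t) * v))
  with ((F s (x t) - F t (x t) - (s - t) * Ft t (x t))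
        + ((Fx s c - Fx t (x t)) * (x s - x t)
           + Fx t (x t) * (x s - x t - (s - t) * v)))
  by (rewrite <- (Rplus_0_r (F s (x s))), <- (Rplus_opp_r (F s (x t)));
      replace (F s (x s)) with (F s (x t) + Fx s c * (x s - x t)) by lra; ring).
eapply Rle_trans; [apply Rabs_triang|].
eapply Rle_trans; [apply Rplus_le_compat_l, Rabs_triang|].
rewrite !Rabs_mult.
set (h := Rabs (s - t)) in *.
assert (hh : 0 <= h) by apply Rabs_pos.
assert (hxs : Rabs (x s - x t) <= B * h).
{ replace (x s - x t) with ((x s - x t - (s - t) * v) + (s - t) * v) by ring.
  eapply Rle_trans; [apply Rabs_triang|]. rewrite (Rabs_mult (s - t)).
  fold h. unfold B. lra. }
assert (b1 : Rabs (Fx s c - Fx t (x t)) * Rabs (x s - x t) <= eps / 3 * h).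
{ replace (eps / 3 * h) with (eps / 3 / B * (B * h)) by (field; lra).
  apply Rmult_le_compat; try apply Rabs_pos; lra. }
assert (b2 : Rabs (Fx t (x t)) * Rabs (x s - x t - (s - t) * v) <= eps / 3 * h).
{ replace (eps / 3 * h) with (A * (eps / 3 / A * h)) by (field; lra).
  apply Rmult_le_compat; try apply Rabs_pos; [unfold A; lra | lra]. }
nra.
Qed.

(** * Uniform remainder bounds along a trajectory *)

(** Local bounds around each point of the curve are made uniform by compactness of [0,T]. *)
Lemma is_bigO_pow_0_along (T : R) (F : R -> R -> R) (x : R -> R) :
  Cn_strip T 0 F ->
  (forall t, 0 <= t <= T -> exists v, is_derive_on T x t v) ->
  is_bigO_pow T 0 (fun t d => F t (x t + d)).
Proof.
intros cF hx.
assert (hloc : forall t, exists d : posreal, 0 <= t <= T ->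
  (* Keeping the radius below the inverse of the local bound makes a uniform lower bound [d] on the
     radii yield the uniform value bound 1/d as well. *)
  d <= / (Rabs (F t (x t)) + 1) /\
  forall s e, 0 <= s <= T -> Rabs (s - t) < d -> Rabs e < d ->
    Rabs (F s (x s + e)) <= Rabs (F t (x t)) + 1).
(* The gauge must be defined on all of R; outside [0,T] it takes the dummy value 1. *)
{ intros t. destruct (classic (0 <= t <= T)) as [ht|ht];
    [|exists (mkposreal 1 Rlt_0_1); tauto].
  destruct (hx t ht) as [v hv].
  destruct (proj1 (continuous_strip_iff T _) cF t (x t) ht 1 Rlt_0_1)
    as [d1 [hd1 Hd1]].
  destruct (is_derive_on_continuous T x t v ht hv (d1 / 2) ltac:(lra))
    as [d2 [hd2 Hd2]].
  assert (hi : 0 < / (Rabs (F t (x t)) + 1)).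
  { apply Rinv_0_lt_compat. pose proof (Rabs_pos (F t (x t))). lra. }
  assert (hm : 0 < Rmin (/ (Rabs (F t (x t)) + 1)) (Rmin (d1 / 2) d2)).
  { repeat apply Rmin_pos; lra. }
  exists (mkposreal _ hm). intros _. split; [apply Rmin_l|].
  simpl. intros s e hs hst he.
  assert (m1 := Rlt_le_trans _ _ _ hst (Rmin_r _ _)).
  assert (k1 := Rlt_le_trans _ _ _ m1 (Rmin_l _ _)).
  assert (k2 := Rlt_le_trans _ _ _ m1 (Rmin_r _ _)).
  assert (m2 := Rlt_le_trans _ _ _ he (Rmin_r _ _)).
  assert (k3 := Rlt_le_trans _ _ _ m2 (Rmin_l _ _)).
  specialize (Hd2 s hs k2).
  assert (hb : Rabs (x s + e - x t) < d1).
  { replace (x s + e - x t) with ((x s - x t) + e) by ring.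
    eapply Rle_lt_trans; [apply Rabs_triang|]. lra. }
  specialize (Hd1 s _ hs ltac:(lra) hb).
  replace (F s (x s + e)) with (F t (x t) + (F s (x s + e) - F t (x t))) by ring.
  eapply Rle_trans; [apply Rabs_triang|]. lra. }
set (delta := fun t => proj1_sig (constructive_indefinite_description _ (hloc t))).
assert (Hdelta := fun t =>
  proj2_sig (constructive_indefinite_description _ (hloc t))).
destruct (compactness_value_1d 0 T delta) as [d Hd].
exists (/ d), d. split; [apply cond_pos|].
intros s e hs he. simpl. rewrite Rmult_1_r.
(* [compactness_value_1d] provides its cell only under a double negation, so the bound is proved by
   contradiction. *)
apply NNPP. intros hn. apply (Hd s hs). intros [t [ht [hst hdt]]]. apply hn.
destruct (Hdelta t ht) as [h1 h2]. fold (delta t) in h1, h2.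
eapply Rle_trans; [apply (h2 s e hs hst); lra|].
assert (h3 : d <= / (Rabs (F t (x t)) + 1)) by lra.
apply Rinv_le_contravar in h3; [|apply cond_pos].
now rewrite Rinv_inv in h3.
Qed.

(** By the mean value theorem E(t,d) = E'(t,c) d with |c| <= |d|, which gains one power of |d| on
    the same neighbourhood. *)
Lemma is_bigO_pow_antiderivative (T : R) (n : nat) (E E' : R -> R -> R) :
  (forall t d, 0 <= t <= T -> is_derive (E t) d (E' t d)) ->
  (forall t, 0 <= t <= T -> E t 0 = 0) ->
  is_bigO_pow T n E' -> is_bigO_pow T (S n) E.
Proof.
intros H H0 [C [eps [heps HC]]].
(* The sign of [C] is unknown, and monotonicity in |c| requires a nonnegative constant. *)
exists (Rabs C), eps. split; [exact heps|]. intros t d ht hd.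
destruct (MVT_is_derive (E t) (E' t) 0 d) as [c [hc Hc]].
{ intros z. now apply H. }
rewrite H0, !Rminus_0_r in Hc by exact ht. rewrite !Rminus_0_r in hc.
rewrite Hc, Rabs_mult. simpl.
replace (Rabs C * (Rabs d * Rabs d ^ n))
  with (Rabs C * Rabs d ^ n * Rabs d) by ring.
apply Rmult_le_compat_r; [apply Rabs_pos|].
eapply Rle_trans; [apply HC; [exact ht|lra]|].
apply Rle_trans with (Rabs C * Rabs c ^ n).
- apply Rmult_le_compat_r; [apply pow_le, Rabs_pos|apply Rle_abs].
- apply Rmult_le_compat_l; [apply Rabs_pos|].
  apply pow_incr. split; [apply Rabs_pos|exact hc].
Qed.

(** * Successive x-derivatives on the strip *)

(** One function [Fxt] serves as t-derivative of [Fx] and x-derivative of [Ft], by symmetry of mixed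
    partials, so the step can be iterated along x-derivatives at the cost of one order each time. *)
Lemma Cn_strip_partials_step (T : R) (n : nat) (F Ft Fx : R -> R -> R) :
  0 < T ->
  (forall t x, 0 <= t <= T ->
     is_derive_on T (fun s => F s x) t (Ft t x) /\
     is_derive (F t) x (Fx t x)) ->
  Cn_strip T (S n) Ft -> Cn_strip T (S n) Fx ->
  exists Fxt Fxx : R -> R -> R,
    (forall t x, 0 <= t <= T ->
       is_derive_on T (fun s => Fx s x) t (Fxt t x) /\
       is_derive (Fx t) x (Fxx t x)) /\
    (forall t x, 0 <= t <= T -> is_derive (Ft t) x (Fxt t x)) /\
    Cn_strip T n Fxt /\ Cn_strip T n Fxx.
Proof.
intros hT H [Ftt [Ftx [Ht [_ ctx]]]] [Fxt [Fxx [Hx [cxt cxx]]]].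
exists Fxt, Fxx. split; [exact Hx|split; [|split; assumption]].
intros t x ht.
rewrite <- (mixed_partials_strip T F Ft Fx Ftx Fxt); try assumption.
- now apply Ht.
- intros s y hs. now apply Ht.
- intros s y hs. now apply Hx.
- exact (Cn_strip_continuous T n _ ctx).
- exact (Cn_strip_continuous T n _ cxt).
Qed.

(** * The HJB equation differentiated in x *)

Lemma is_derive_of_zero (h : R -> R) (x v : R) :
  (forall y, h y = 0) -> is_derive h x v -> v = 0.
Proof.
intros H hv. rewrite <- (is_derive_unique _ _ _ hv).
rewrite (Derive_ext h (fun _ => 0)) by exact H. apply Derive_const.
Qed.

(* Stated with the eta-expanded function over R that auto_derive produces. *)
Lemma Derive_eta_eq (h : R -> R) (x v : R) :
  is_derive h x v -> Derive (fun y : R => h y) x = v.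
Proof. exact (is_derive_unique h x v). Qed.

(** Time is frozen: [c] stands for g^2/r, [a1] to [a4] for the x-derivatives of J, and [d0] to [d3]
    for J_t and its x-derivatives. Each identity holds for all x, so its derivative vanishes and is
    the next identity. *)
Lemma HJB_x_derivatives (c : R)
    (f0 f1 f2 f3 l0 l1 l2 l3 a1 a2 a3 a4 d0 d1 d2 d3 : R -> R) :
  (forall x, is_derive f0 x (f1 x)) -> (forall x, is_derive f1 x (f2 x)) ->
  (forall x, is_derive f2 x (f3 x)) ->
  (forall x, is_derive l0 x (l1 x)) -> (forall x, is_derive l1 x (l2 x)) ->
  (forall x, is_derive l2 x (l3 x)) ->
  (forall x, is_derive a1 x (a2 x)) -> (forall x, is_derive a2 x (a3 x)) ->
  (forall x, is_derive a3 x (a4 x)) ->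
  (forall x, is_derive d0 x (d1 x)) -> (forall x, is_derive d1 x (d2 x)) ->
  (forall x, is_derive d2 x (d3 x)) ->
  (forall x, d0 x + l0 x - / 2 * c * a1 x ^ 2 + f0 x * a1 x = 0) ->
  forall x,
    d1 x + l1 x - c * (a1 x * a2 x) + f1 x * a1 x + f0 x * a2 x = 0 /\
    d2 x + l2 x - c * (a2 x * a2 x + a1 x * a3 x)
      + f2 x * a1 x + 2 * (f1 x * a2 x) + f0 x * a3 x = 0 /\
    d3 x + l3 x - c * (3 * (a2 x * a3 x) + a1 x * a4 x)
      + f3 x * a1 x + 3 * (f2 x * a2 x) + 3 * (f1 x * a3 x) + f0 x * a4 x = 0.
Proof.
intros Hf0 Hf1 Hf2 Hl0 Hl1 Hl2 Ha1 Ha2 Ha3 Hd0 Hd1 Hd2 E0.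
assert (E1 : forall x,
  d1 x + l1 x - c * (a1 x * a2 x) + f1 x * a1 x + f0 x * a2 x = 0).
{ intros x. refine (is_derive_of_zero _ x _ E0 _). auto_derive.
  - repeat split; eexists; eauto.
  - rewrite (Derive_eta_eq _ _ _ (Hd0 x)),
      (Derive_eta_eq _ _ _ (Hl0 x)),
      (Derive_eta_eq _ _ _ (Ha1 x)),
      (Derive_eta_eq _ _ _ (Hf0 x)).
    field. }
assert (E2 : forall x,
  d2 x + l2 x - c * (a2 x * a2 x + a1 x * a3 x)
    + f2 x * a1 x + 2 * (f1 x * a2 x) + f0 x * a3 x = 0).
{ intros x. refine (is_derive_of_zero _ x _ E1 _). auto_derive.
  - repeat split; eexists; eauto.
  - rewrite (Derive_eta_eq _ _ _ (Hd1 x)),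
      (Derive_eta_eq _ _ _ (Hl1 x)),
      (Derive_eta_eq _ _ _ (Ha1 x)),
      (Derive_eta_eq _ _ _ (Ha2 x)),
      (Derive_eta_eq _ _ _ (Hf0 x)),
      (Derive_eta_eq _ _ _ (Hf1 x)).
    ring. }
intros x. repeat split; [apply E1|apply E2|].
refine (is_derive_of_zero _ x _ E2 _). auto_derive.
- repeat split; eexists; eauto.
- rewrite (Derive_eta_eq _ _ _ (Hd2 x)),
      (Derive_eta_eq _ _ _ (Hl2 x)),
      (Derive_eta_eq _ _ _ (Ha1 x)),
      (Derive_eta_eq _ _ _ (Ha2 x)),
      (Derive_eta_eq _ _ _ (Ha3 x)),
      (Derive_eta_eq _ _ _ (Hf0 x)),
      (Derive_eta_eq _ _ _ (Hf1 x)),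
      (Derive_eta_eq _ _ _ (Hf2 x)).
  ring.
Qed.

(** [ex_derive_n h (S k) x] is differentiability of [Derive_n h k] at [x], hence the strict bound on
    [k]. *)
Lemma Cn_is_derive_n (n k : nat) (h : R -> R) (x : R) :
  Cn n h -> (k < n)%nat -> is_derive (Derive_n h k) x (Derive_n h (S k) x).
Proof.
intros H hk. apply Derive_correct. exact (proj1 (H (S k) x hk)).
Qed.

(** * Taylor expansions along the trajectory *)

Lemma is_bigO_pow_ext (T : R) (n : nat) (E E' : R -> R -> R) :
  (forall t d, 0 <= t <= T -> E t d = E' t d) ->
  is_bigO_pow T n E -> is_bigO_pow T n E'.
Proof.
intros H [C [eps [heps HC]]]. exists C, eps. split; [exact heps|].
intros t d ht hd. rewrite <- H by exact ht. now apply HC.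
Qed.

Lemma is_bigO_pow_scal (T : R) (n : nat) (k : R) (E : R -> R -> R) :
  is_bigO_pow T n E -> is_bigO_pow T n (fun t d => k * E t d).
Proof.
intros [C [eps [heps HC]]]. exists (Rabs k * C), eps. split; [exact heps|].
intros t d ht hd. rewrite Rabs_mult, Rmult_assoc.
apply Rmult_le_compat_l; [apply Rabs_pos|now apply HC].
Qed.

(** The d-derivative of each Taylor remainder is the remainder for the next x-derivative, and each
    vanishes at d = 0. Starting from [J4] = O(1), integration raises the order by one per level. *)
Lemma Taylor_x_expansions (T : R) (J0 J1 J2 J3 J4 : R -> R -> R) (x : R -> R) :
  (forall t y, 0 <= t <= T -> is_derive (J0 t) y (J1 t y)) ->
  (forall t y, 0 <= t <= T -> is_derive (J1 t) y (J2 t y)) ->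
  (forall t y, 0 <= t <= T -> is_derive (J2 t) y (J3 t y)) ->
  (forall t y, 0 <= t <= T -> is_derive (J3 t) y (J4 t y)) ->
  Cn_strip T 0 J4 ->
  (forall t, 0 <= t <= T -> exists v, is_derive_on T x t v) ->
  is_bigO_pow T 4 (fun t d => J0 t (x t + d)
    - (J0 t (x t) + J1 t (x t) * d + / 2 * J2 t (x t) * d ^ 2
       + / 6 * J3 t (x t) * d ^ 3)) /\
  is_bigO_pow T 3 (fun t d => J1 t (x t + d)
    - (J1 t (x t) + J2 t (x t) * d + / 2 * J3 t (x t) * d ^ 2)).
Proof.
intros H0 H1 H2 H3 c4 hx.
assert (B3 : is_bigO_pow T 3 (fun t d => J1 t (x t + d)
    - (J1 t (x t) + J2 t (x t) * d + / 2 * J3 t (x t) * d ^ 2))).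
{ apply is_bigO_pow_antiderivative
    with (fun t d => J2 t (x t + d) - (J2 t (x t) + J3 t (x t) * d)).
  { intros t d ht. auto_derive.
    - repeat split. eexists; now apply H1.
    - rewrite (Derive_eta_eq _ _ _ (H1 t (x t + d) ht)). field. }
  { intros t ht. rewrite Rplus_0_r. ring. }
  apply is_bigO_pow_antiderivative
    with (fun t d => J3 t (x t + d) - J3 t (x t)).
  { intros t d ht. auto_derive.
    - repeat split. eexists; now apply H2.
    - rewrite (Derive_eta_eq _ _ _ (H2 t (x t + d) ht)). ring. }
  { intros t ht. rewrite Rplus_0_r. ring. }
  apply is_bigO_pow_antiderivative with (fun t d => J4 t (x t + d)).
  { intros t d ht. auto_derive.
    - repeat split. eexists; now apply H3.
    - rewrite (Derive_eta_eq _ _ _ (H3 t (x t + d) ht)). ring. }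
  { intros t ht. rewrite Rplus_0_r. ring. }
  now apply is_bigO_pow_0_along. }
split; [|exact B3].
refine (is_bigO_pow_antiderivative T 3 _ _ _ _ B3).
- intros t d ht. auto_derive.
  + repeat split. eexists; now apply H0.
  + rewrite (Derive_eta_eq _ _ _ (H0 t (x t + d) ht)). field.
- intros t ht. rewrite Rplus_0_r. ring.
Qed.

(* FG and FP are chosen before the horizon, the initial state, the terminal
   cost, J and the trajectory. Their argument lists (state, G) and
   (state, G, P) express that the equation for G involves neither P nor S and
   that the equation for P does not involve S. *)
Theorem mainTheorem6 (f l : R -> R) (g r : R)
  (hr : 0 < r) (hf : Cn 5 f) (hl : Cn 5 l) :
  exists (FG : R -> R -> R) (FP : R -> R -> R -> R),
  forall (cT : R -> R) (T x0 : R) (J : R -> R -> R) (xbar ubar : R -> R),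
    Cn 5 cT ->
    0 < T ->
    Cn_strip T 4 J ->
    HJB f l cT g r T J ->
    optimal_nominal f l cT g r T x0 J xbar ubar ->
    let G := fun t => Derive (J t) (xbar t) in
    let P := fun t => Derive_n (J t) 2 (xbar t) in
    let S := fun t => Derive_n (J t) 3 (xbar t) in
    let fx := fun t => Derive f (xbar t) in
    let fxx := fun t => Derive_n f 2 (xbar t) in
    let fxxx := fun t => Derive_n f 3 (xbar t) in
    let lx := fun t => Derive l (xbar t) in
    let lxx := fun t => Derive_n l 2 (xbar t) in
    let lxxx := fun t => Derive_n l 3 (xbar t) in
    let K := fun t => - (g / r) * P t in
    let K2 := fun t => - (g / (2 * r)) * S t in
    is_bigO_pow T 4 (fun t d =>
      J t (xbar t + d)
      - (J t (xbar t) + G t * d + / 2 * P t * d ^ 2 + / 6 * S t * d ^ 3)) /\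
    (exists Gdot Pdot Sdot : R -> R,
       forall t : R, 0 <= t <= T ->
         is_derive_on T G t (Gdot t) /\
         is_derive_on T P t (Pdot t) /\
         is_derive_on T S t (Sdot t) /\
         Gdot t + lx t + fx t * G t = 0 /\
         Pdot t + lxx t + P t * fx t + fx t * P t
           - P t * (g ^ 2 / r) * P t + fxx t * G t = 0 /\
         Sdot t + lxxx t + P t * fxx t + 2 * fxx t * P t
           + fx t * S t + 2 * S t * fx t
           - P t * (g ^ 2 / r) * S t - 2 * S t * (g ^ 2 / r) * P t
           + fxxx t * G t = 0 /\
         Gdot t = FG (xbar t) (G t) /\
         Pdot t = FP (xbar t) (G t) (P t)) /\
    (forall t : R, 0 <= t <= T -> ubar t = - (g / r) * G t) /\
    is_bigO_pow T 3 (fun t d =>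
      optimal_feedback g r J t (xbar t + d)
      - (ubar t + K t * d + K2 t * d ^ 2)).
Proof.
(* The equations for G and P, solved for their time derivatives. *)
exists (fun x G => - Derive l x - Derive f x * G),
  (fun x G P => - Derive_n l 2 x - 2 * Derive f x * P + g ^ 2 / r * P ^ 2
                - Derive_n f 2 x * G).
intros cT T x0 J xbar ubar _ hT [D0 [J1 [A0 [cD0 cJ1]]]] [hjb _]
  [[[_ [_ hx]] _] hu] G P S fx fxx fxxx lx lxx lxxx K K2.
(* In the resulting tower [Jk] is the k-th x-derivative of J and [Dk] its t-derivative; [Ak] gives
   both partials of [Jk] (of J for k = 0), and [Bk] says that [Dk] has x-derivative [D(k+1)]. *)
destruct (Cn_strip_partials_step T 2 J D0 J1 hT A0 cD0 cJ1)
  as [D1 [J2 [A1 [B0 [cD1 cJ2]]]]].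
destruct (Cn_strip_partials_step T 1 J1 D1 J2 hT A1 cD1 cJ2)
  as [D2 [J3 [A2 [B1 [cD2 cJ3]]]]].
destruct (Cn_strip_partials_step T 0 J2 D2 J3 hT A2 cD2 cJ3)
  as [D3 [J4 [A3 [B2 [cD3 cJ4]]]]].
assert (E1 : forall t y, 0 <= t <= T -> Derive (J t) y = J1 t y).
{ intros t y ht. apply is_derive_unique. now apply A0. }
assert (E2 : forall t y, 0 <= t <= T -> Derive_n (J t) 2 y = J2 t y).
{ intros t y ht. apply is_derive_unique.
  apply is_derive_ext with (J1 t); [|now apply A1].
  intros z. symmetry. now apply E1. }
assert (E3 : forall t y, 0 <= t <= T -> Derive_n (J t) 3 y = J3 t y).
{ intros t y ht. apply is_derive_unique.
  apply is_derive_ext with (J2 t); [|now apply A2].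
  intros z. symmetry. now apply E2. }
(* Inserting the feedback law into the dynamics gives the closed-loop equation. *)
assert (hx' : forall t, 0 <= t <= T ->
  is_derive_on T xbar t (f (xbar t) - g ^ 2 / r * J1 t (xbar t))).
{ intros t ht.
  replace (f (xbar t) - g ^ 2 / r * J1 t (xbar t))
    with (f (xbar t) + g * ubar t); [now apply hx|].
  rewrite hu by exact ht. unfold optimal_feedback.
  rewrite E1 by exact ht. field. lra. }
destruct (Taylor_x_expansions T J J1 J2 J3 J4 xbar) as [TJ TJ1];
  try assumption.
{ intros; now apply A0. }
{ intros; now apply A1. }
{ intros; now apply A2. }
{ intros; now apply A3. }
{ intros t ht. eexists. now apply hx'. }
assert (hD0 : forall t y, 0 <= t <= T ->
  D0 t y + l y - / 2 * (g ^ 2 / r) * J1 t y ^ 2 + f y * J1 t y = 0).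
{ intros t y ht. destruct (hjb t y ht) as [Jt [h1 h2]].
  rewrite E1 in h2 by exact ht.
  rewrite (is_derive_on_unique T (fun s => J s y) t (D0 t y) Jt);
    [exact h2|exact hT|exact ht|now apply A0|exact h1]. }
split; [|split; [|split]].
- refine (is_bigO_pow_ext T 4 _ _ _ TJ). intros t d ht. unfold G, P, S.
  now rewrite E1, E2, E3.
- exists (fun t => - Derive l (xbar t) - Derive f (xbar t) * G t),
    (fun t => - Derive_n l 2 (xbar t) - 2 * Derive f (xbar t) * P t
              + g ^ 2 / r * P t ^ 2 - Derive_n f 2 (xbar t) * G t),
    (fun t => - lxxx t - 3 * fxx t * P t - 3 * fx t * S t
              + 3 * (g ^ 2 / r) * P t * S t - fxxx t * G t).
  (* The chain rule along [xbar], transferred to any [H] that equals F(s, xbar s) on [0,T] only; it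
     is applied to G, P and S. *)
  assert (hc : forall F Fd F' : R -> R -> R, Cn_strip T 0 F' ->
    (forall t y, 0 <= t <= T ->
       is_derive_on T (fun s => F s y) t (Fd t y) /\
       is_derive (F t) y (F' t y)) ->
    forall (H : R -> R) t v, 0 <= t <= T ->
    (forall s, 0 <= s <= T -> H s = F s (xbar s)) ->
    v = Fd t (xbar t)
        + F' t (xbar t) * (f (xbar t) - g ^ 2 / r * J1 t (xbar t)) ->
    is_derive_on T H t v).
  { intros F Fd F' cF' A H t v ht EH ->.
    assert (hF := is_derive_on_comp_strip T F Fd F' xbar t _ A cF' ht
                    (hx' t ht)).
    apply is_derive_on_iff; [exact ht|]. intros eps heps.
    destruct (proj1 (is_derive_on_iff _ _ _ _ ht) hF eps heps)
      as [d [hd Hd]].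
    exists d. split; [exact hd|]. intros s hs hst.
    rewrite !EH by assumption. now apply Hd. }
  intros t ht.
  destruct (HJB_x_derivatives (g ^ 2 / r)
    f (Derive f) (Derive_n f 2) (Derive_n f 3)
    l (Derive l) (Derive_n l 2) (Derive_n l 3)
    (J1 t) (J2 t) (J3 t) (J4 t) (D0 t) (D1 t) (D2 t) (D3 t))
    with (x := xbar t) as [Q1 [Q2 Q3]];
    try (intros y; first
      [ now apply (Cn_is_derive_n 5 0 _ y); [assumption|lia]
      | now apply (Cn_is_derive_n 5 1 _ y); [assumption|lia]
      | now apply (Cn_is_derive_n 5 2 _ y); [assumption|lia]
      | now apply A1 | now apply A2 | now apply A3
      | now apply B0 | now apply B1 | now apply B2 | now apply hD0 ]).
  assert (EG : forall s, 0 <= s <= T -> G s = J1 s (xbar s)).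
  { intros s hs. exact (E1 s _ hs). }
  assert (EP : forall s, 0 <= s <= T -> P s = J2 s (xbar s)).
  { intros s hs. exact (E2 s _ hs). }
  assert (ES : forall s, 0 <= s <= T -> S s = J3 s (xbar s)).
  { intros s hs. exact (E3 s _ hs). }
  assert (RG := EG t ht). assert (RP := EP t ht). assert (RS := ES t ht).
  (* [Q1], [Q2], [Q3] are solved for [D1], [D2], [D3]; adding the next x-derivative of J times f -
     (g^2/r) [J1] removes that derivative. *)
  split; [|split; [|split]].
  + apply (hc J1 D1 J2 (Cn_strip_continuous T 2 _ cJ2) A1 _ _ _ ht EG).
    rewrite RG. lra.
  + apply (hc J2 D2 J3 (Cn_strip_continuous T 1 _ cJ3) A2 _ _ _ ht EP).
    rewrite RG, RP. lra.
  + apply (hc J3 D3 J4 cJ4 A3 _ _ _ ht ES).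
    unfold lxxx, fxx, fx, fxxx. rewrite RG, RP, RS. lra.
  + unfold lx, fx, lxx, fxx. repeat split; ring.
- intros t ht. rewrite hu by exact ht. reflexivity.
(* The feedback is -g/r times J^x; the factor 1/2 in the quadratic term of its expansion produces
   the 2r in [K2]. *)
- refine (is_bigO_pow_ext T 3 _ _ _ (is_bigO_pow_scal T 3 (- (g / r)) _ TJ1)).
  intros t d ht. unfold K, K2, P, S. rewrite hu by exact ht.
  unfold optimal_feedback.
  rewrite !E1, E2, E3 by exact ht. field. lra.
Qed.
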